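(* Let $A,B$ be irreducible, non-permutation square matrices with entries in $\{0,1\}$. Then the following three conditions are equivalent: (i) $(X_A,\sigma_A)$ and $(X_B,\sigma_B)$ are uniformly continuous orbit equivalent. (ii) $(X_A,\sigma_A)$ and $(X_B,\sigma_B)$ are eventually conjugate. (iii) $(X_A,\sigma_A)$ and $(X_B,\sigma_B)$ are $\Gamma$-strongly continuous orbit equivalent.
   Context: For an irreducible non-permutation matrix $A=[A(i,j)]_{i,j=1}^N$ with entries in $\{0,1\}$, $X_A$ is the set of sequences $(x_n)_{n\in\mathbb{N}}$, $x_n\in\{1,\dots,N\}$, with $A(x_n,x_{n+1})=1$ for all $n$, with the product topology, and $\sigma_A((x_n)_n)=(x_{n+1})_n$. $\mathbb{Z}_+$ is the set of nonnegative integers. A homeomorphism $h:X_A\to X_B$ gives rise to a continuous orbit equivalence if there are continuous $k_1,l_1:X_A\to\mathbb{Z}_+$, $k_2,l_2:X_B\to\mathbb{Z}_+$ with $\sigma_B^{k_1(x)}(h(\sigma_A(x)))=\sigma_B^{l_1(x)}(h(x))$ for $x\in X_A$ and $\sigma_A^{k_2(w)}(h^{-1}(\sigma_B(w)))=\sigma_A^{l_2(w)}(h^{-1}(w))$ for $w\in X_B$. Its cocycle functions are $c_1=l_1-k_1$ and $c_2=l_2-k_2$. $\Gamma_A$ (continuous full group) is the group of homeomorphisms $\tau$ of $X_A$ for which there are continuous $k_\tau,l_\tau:X_A\to\mathbb{Z}_+$ with $\sigma_A^{k_\tau(x)}(\tau(x))=\sigma_A^{l_\tau(x)}(x)$ for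 all $x\in X_A$; $d_\tau=l_\tau-k_\tau$, which does not depend on the choice of $k_\tau,l_\tau$. $\Gamma_A^{\mathrm{AF}}$ is the subgroup of those $\tau\in\Gamma_A$ for which one may take $k_\tau=l_\tau$. $(X_A,\sigma_A)$ and $(X_B,\sigma_B)$ are: - eventually conjugate if there is a homeomorphism giving rise to a continuous orbit equivalence for which one may take $c_1\equiv1$ and $c_2\equiv1$; - uniformly continuous orbit equivalent if there is a homeomorphism $h:X_A\to X_B$ giving rise to a continuous orbit equivalence such that for any $\tau_1\in\Gamma_A^{\mathrm{AF}}$, $\tau_2\in\Gamma_B^{\mathrm{AF}}$ there exist natural numbers $K_{\tau_1},K_{\tau_2}$ with $\sigma_B^{K_{\tau_1}}(h(\tau_1(x)))=\sigma_B^{K_{\tau_1}}(h(x))$ for all $x\in X_A$ and $\sigma_A^{K_{\tau_2}}(h^{-1}(\tau_2(w)))=\sigma_A^{K_{\tau_2}}(h^{-1}(w))$ for all $w\in X_B$; - $\Gamma$-strongly continuous orbit equivalent if there is a homeomorphism $h:X_A\to X_B$ giving rise to a continuous orbit equivalence and an element $\tau\in\Gamma_A$ such that $c_1=1-d_\tau+d_\tau\circ\sigma_A$. *)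

(* Defs.v *)
From mathcomp Require Import all_boot all_order all_algebra all_classical.
From mathcomp Require Import topology function_spaces.

Set Implicit Arguments.
Unset Strict Implicit.
Unset Printing Implicit Defensive.

Import GRing.Theory.
Local Open Scope classical_set_scope.
Local Open Scope ring_scope.

Section Matrices.
Variables (N : nat) (A : 'M[nat]_N).

Definition zero_one_mx := forall i j, A i j = 0%N \/ A i j = 1%N.

(* The exponent is required to be positive, so that the 1 x 1 zero matrix is
   not irreducible. *)
Definition irreducible_mx :=
  forall i j, exists2 n, (0 < n)%N & (0 < (A ^+ n) i j)%N.

End Matrices.

Section OneSidedShift.
Variables (N : nat) (A : 'M[nat]_N).

(* {ptws _ -> _} is the product topology and discrete_topology gives 'I_N the
   discrete topology; sequences are indexed from 0. *)
Definition admissible : set {ptws nat -> discrete_topology 'I_N} :=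
  [set x | forall n, A (x n) (x n.+1) = 1%N].

Definition shift_space : topologicalType := set_type admissible.

Lemma shift_admissible (x : shift_space) :
  (fun n => set_val x n.+1) \in admissible.
Proof. by apply: mem_set => n; exact: (set_mem (valP x)). Qed.

Definition shift (x : shift_space) : shift_space :=
  exist _ (fun n => set_val x n.+1) (shift_admissible x).

End OneSidedShift.

Record homeo (T U : topologicalType) := Homeo {
  homeo_fun :> T -> U;
  homeo_inv : U -> T;
  homeo_funK : cancel homeo_fun homeo_inv;
  homeo_invK : cancel homeo_inv homeo_fun;
  homeo_fun_continuous : continuous homeo_fun;
  homeo_inv_continuous : continuous homeo_inv }.

(* Used both for c_i = l_i - k_i and for d_tau = l_tau - k_tau. *)
Definition cocycle (T : Type) (k l : T -> nat) (x : T) : int :=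
  (l x)%:Z - (k x)%:Z.

Section FullGroup.
Variables (N : nat) (A : 'M[nat]_N).
Implicit Types tau : homeo (shift_space A) (shift_space A).

Definition full_group_data tau (k l : shift_space A -> nat) : Prop :=
  [/\ continuous k, continuous l &
      forall x, iter (k x) (@shift N A) (tau x) = iter (l x) (@shift N A) x].

Definition full_group : set (homeo (shift_space A) (shift_space A)) :=
  [set tau | exists k l, full_group_data tau k l].

Definition AF_full_group : set (homeo (shift_space A) (shift_space A)) :=
  [set tau | exists k, full_group_data tau k k].

End FullGroup.

Section OrbitEquivalence.
Variables (N M : nat) (A : 'M[nat]_N) (B : 'M[nat]_M).
Implicit Types h : homeo (shift_space A) (shift_space B).

Definition coe_data h (k1 l1 : shift_space A -> nat)
    (k2 l2 : shift_space B -> nat) : Prop :=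
  [/\ continuous k1 /\ continuous l1,
      continuous k2 /\ continuous l2,
      forall x : shift_space A,
        iter (k1 x) (@shift M B) (h (shift x)) =
        iter (l1 x) (@shift M B) (h x) &
      forall w : shift_space B,
        iter (k2 w) (@shift N A) (homeo_inv h (shift w)) =
        iter (l2 w) (@shift N A) (homeo_inv h w)].

Definition gives_coe h : Prop := exists k1 l1 k2 l2, coe_data h k1 l1 k2 l2.

Definition eventually_conjugate : Prop :=
  exists h k1 l1 k2 l2,
    [/\ coe_data h k1 l1 k2 l2,
        forall x, cocycle k1 l1 x = 1 &
        forall w, cocycle k2 l2 w = 1].

Definition uniformly_coe : Prop :=
  exists2 h, gives_coe h &
    forall tau1 tau2, AF_full_group (A := A) tau1 ->
      AF_full_group (A := B) tau2 ->
      exists K1 K2 : nat,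
        (forall x : shift_space A,
          iter K1 (@shift M B) (h (tau1 x)) = iter K1 (@shift M B) (h x)) /\
        (forall w : shift_space B,
          iter K2 (@shift N A) (homeo_inv h (tau2 w)) =
          iter K2 (@shift N A) (homeo_inv h w)).

(* An element tau of full_group A, together with functions k, l computing
   d_tau. *)
Definition Gamma_strongly_coe : Prop :=
  exists h k1 l1 k2 l2,
    coe_data h k1 l1 k2 l2 /\
    exists tau k l,
      full_group_data (A := A) tau k l /\
      forall x, cocycle k1 l1 x =
        1 - cocycle k l x + cocycle k l (shift x).

End OrbitEquivalence.

(* Main.v *)
Require Import Defs.
From mathcomp Require Import all_boot all_order all_algebra all_classical.
From mathcomp Require Import topology function_spaces.
From mathcomp Require Import zify.

(* Call y related to x with lag a - b when sigma^a x = sigma^b y.  Transporting lags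
   by h gives a cocycle, and cylinders are too rich to consist of eventually periodic
   points, so identities between lags that hold on a nonempty open set are forced.

   If h is uniform, it preserves the tail relation (lag 0) in both directions; tail
   classes are dense in the p periodic components X_0, ..., X_(p-1) of X_A, hence
   c_1 is constant on each X_i.  Its sum over a period is p: it is +-p because h^-1
   has the same properties, and -p would make sigma_A injective.  So
   c_1 = 1 + q o sigma_A - q for a function q that is constant on components.  Where
   c_1 < 0, a pigeonhole argument in the finite fibres of sigma_A^n shows that sigma_A
   is injective on X_i; exchanging X_i and X_(i+1) along sigma_A then makes q more
   monotone.  A monotone q is constant, and then c_1 = 1.  For condition (iii) the
   potential is d_tau, which h o tau^-1 removes at once. *)

Set Implicit Arguments.
Unset Strict Implicit.
Unset Printing Implicit Defensive.

Import Order.TTheory GRing.Theory Num.Theory.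

(** * Prefixes and continuity *)

Section Prefixes.
Local Open Scope classical_set_scope.
Variables (N : nat) (A : 'M[nat]_N).
Implicit Types x y z : shift_space A.

Definition letter x n : 'I_N := set_val x n.

Definition agree n x y := forall k, k < n -> letter x k = letter y k.

Lemma letter_inj x y : letter x =1 letter y -> x = y.
Proof.
move=> e; apply: val_inj; apply: functional_extensionality_dep => n.
exact: e.
Qed.

Lemma letter_adm x n : A (letter x n) (letter x n.+1) = 1%N.
Proof. exact: (set_mem (valP x)). Qed.

Definition point_of (u : nat -> 'I_N)
    (h : forall n, A (u n) (u n.+1) = 1%N) : shift_space A :=
  exist _ (u : {ptws nat -> discrete_topology 'I_N}) (mem_set h).

Lemma letter_shift x n : letter (shift x) n = letter x n.+1.
Proof. by []. Qed.

Lemma letter_iter x n k : letter (iter n (@shift N A) x) k = letter x (n + k).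
Proof.
elim: n k => [//|n IH] k.
by rewrite iterS letter_shift IH addnS.
Qed.

Lemma agree_sym n x y : agree n x y -> agree n y x.
Proof. by move=> h k kn; rewrite h. Qed.

Lemma agree_trans n y x z : agree n x y -> agree n y z -> agree n x z.
Proof. by move=> h g k kn; rewrite h // g. Qed.

Lemma agreeW m n x y : m <= n -> agree n x y -> agree m x y.
Proof. by move=> mn h k km; apply: h; apply: leq_trans mn. Qed.

Local Notation seqs := {ptws nat -> discrete_topology 'I_N}.

Lemma nbhs_cylinder (u : seqs) n :
  nbhs u [set v : seqs | forall k, k < n -> u k = v k].
Proof.
elim: n => [|n IH]; first by apply: (@filterS seqs) filterT => v _ k.
have cn : nbhs u [set v : seqs | u n = v n].
  apply: (@proj_continuous nat (fun=> discrete_topology 'I_N) n u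
            [set a | u n = a]).
  by rewrite /nbhs /=; apply/principal_filterP.
apply: filterS (filterI IH cn) => v [h1 h2] k.
by rewrite ltnS leq_eqVlt => /predU1P[->//|]; apply: h1.
Qed.

Lemma nbhs_agree x (U : set (shift_space A)) :
  nbhs x U <-> exists n, forall y, agree n x y -> U y.
Proof.
split=> [Ux|[n nU]]; last first.
  apply: filterS nU _.
  exact: (initial_continuous (nbhs_cylinder (set_val x) n)).
(* Otherwise some [g n] outside [U] agrees with [x] on [n] letters, and such a sequence converges to
   [x] coordinatewise. *)
apply: contrapT => nU.
have /choice[g gP] : forall n, exists y, agree n x y /\ ~ U y.
  move=> n; apply: contrapT => h; apply: nU; exists n => y xy.
  by apply: contrapT => nUy; apply: h; exists y.
have gx : g @ \oo --> x.
  move=> V [V' /= [[W oW <-] Wx WV]].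
  apply: (@filterS _ (g @ \oo) _ _ _ WV).
  have : (fun n => set_val (g n) : seqs) @ \oo
      --> (set_val x : seqs).
    apply/cvg_sup => i S [S' [[T oT] <-] Tx TS].
    apply: (filterS TS); exists i.+1 => // n /= ni.
    by have -> : set_val (g n) i = set_val x i by rewrite -[LHS](gP n).1.
  apply; apply: open_nbhs_nbhs; split => //.
have [n _ /(_ n (leqnn n))] := gx _ Ux.
by have [] := gP n.
Qed.

(** Tychonoff gives a cluster point among all sequences; it is admissible because each of its
    transitions occurs in some [s k]. *)
Lemma compact_limit (s : nat -> shift_space A) :
  exists x, forall m n, exists2 k, n <= k & agree m x (s k).
Proof.
pose T (_ : nat) : topologicalType := discrete_topology 'I_N.
have cT i : compact [set: T i].
  exact/finite_compact/(@finite_finset 'I_N).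
have [] := @tychonoff nat T (fun=> setT) cT
  ((fun n => set_val (s n) : seqs) @ \oo) _.
  by apply: filterE.
move=> u [_ uF].
have us m n : exists2 k, n <= k & forall i, i < m -> u i = letter (s k) i.
  have [|v [[k nk <-] kv]] := uF [set v | exists2 k, n <= k & set_val (s k) = v]
      _ _ (nbhs_cylinder u m).
    by exists n => // k /= nk; exists k.
  by exists k.
have hu n : A (u n) (u n.+1) = 1%N.
  by have [k _ e] := us n.+2 0; rewrite !e // letter_adm.
by exists (point_of hu) => m n; have [k nk e] := us m n; exists k.
Qed.

Lemma locally_constant_agree (T : Type) (f : shift_space A -> T) :
  (forall x, exists n, forall y, agree n x y -> f x = f y) ->
  exists n, forall x y, agree n x y -> f x = f y.
Proof.
move=> lf; apply: contrapT => nf.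
have /choice[s sP] : forall n, exists xy : shift_space A * shift_space A,
    agree n xy.1 xy.2 /\ f xy.1 <> f xy.2.
  move=> n; apply: contrapT => h; apply: nf; exists n => x y xy.
  by apply: contrapT => fxy; apply: h; exists (x, y).
have [x xs] := compact_limit (fun n => (s n).1).
have [n nx] := lf x; have [k nk xk] := xs n n.
have [a b] := sP k; apply: b; rewrite -(nx _ xk); apply: nx.
exact: agree_trans xk (agreeW nk a).
Qed.

Lemma agree_bounded (f : shift_space A -> nat) n :
  (forall x y, agree n x y -> f x = f y) -> exists m, forall x, f x <= m.
Proof.
move=> fn; apply: contrapT => nb.
have /choice[s sP] : forall m, exists x, m < f x.
  move=> m; apply: contrapT => h; apply: nb; exists m => x.
  by rewrite leqNgt; apply/negP => hx; apply: h; exists x.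
have [x xs] := compact_limit s; have [k xk /fn e] := xs n (f x).
by have := sP k; rewrite -e ltnNge xk.
Qed.

Lemma continuous_agree (f : shift_space A -> nat) :
  continuous f -> exists n, forall x y, agree n x y -> f x = f y.
Proof.
move=> cf; apply: locally_constant_agree => x.
have /nbhs_agree : nbhs x [set y | f x = f y]; last by [].
by apply: (cf x [set m | f x = m]); apply/principal_filterP.
Qed.

End Prefixes.

Section Maps.
Local Open Scope classical_set_scope.
Variables (N M : nat) (A : 'M[nat]_N) (B : 'M[nat]_M).

Definition unif_cont (h : shift_space A -> shift_space B) :=
  forall n, exists m, forall x y, agree m x y -> agree n (h x) (h y).

Lemma unif_contP h : continuous h <-> unif_cont h.
Proof.
split=> [ch n|uh x U /nbhs_agree[n nU]]; last first.
  have [m hm] := uh n; apply/nbhs_agree; exists m => y /hm; exact: nU.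
(* For the function sending [x] to the cylinder of [h x], equality of values means agreement of
   images, so local constancy becomes uniform. *)
have [|m hm] := @locally_constant_agree _ A _
    (fun x => [set y | agree n (h x) y]).
  move=> x; have /nbhs_agree[m hm] : nbhs x [set y | agree n (h x) (h y)].
    by apply: ch; apply/nbhs_agree; exists n.
  exists m => y /hm xy; apply/seteqP; split=> z /=; apply: agree_trans => //.
  exact: agree_sym.
exists m => x y /hm e.
by have : [set z | agree n (h y) z] (h y) by []; rewrite -e.
Qed.

End Maps.

(** * Paths, rigidity and periodic components *)

Section Paths.
Variables (N : nat) (A : 'M[nat]_N).
Implicit Types x y z : shift_space A.

Fixpoint path_of n (i j : 'I_N) : Prop :=
  if n is n'.+1 then exists2 k, A i k = 1%N & path_of n' k j else i = j.

Lemma path_of_cat m n i j k :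
  path_of m i j -> path_of n j k -> path_of (m + n) i k.
Proof.
elim: m i => [|m IH] i /=; first by move=> ->.
by move=> [l il lj] jk; exists l => //; apply: IH.
Qed.

Lemma cons_point (i : 'I_N) x :
  A i (letter x 0) = 1%N -> exists2 y, letter y 0 = i & shift y = x.
Proof.
move=> ix; pose u n := if n is n'.+1 then letter x n' else i.
have hu n : A (u n) (u n.+1) = 1%N by case: n => [//|n]; apply: letter_adm.
by exists (point_of hu) => //; apply: letter_inj.
Qed.

Lemma path_point n i x : path_of n i (letter x 0) ->
  exists2 y, letter y 0 = i & iter n (@shift N A) y = x.
Proof.
elim: n i => [|n IH] i /=; first by move=> ->; exists x.
move=> [k ik /IH[y y0 yx]]; rewrite -y0 in ik.
have [z z0 zy] := cons_point ik.
by exists z => //; rewrite -iterS iterSr zy.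
Qed.

Lemma graft n x z : letter x n = letter z 0 ->
  exists2 y, (forall k, k <= n -> letter x k = letter y k) &
    iter n (@shift N A) y = z.
Proof.
elim: n x => [|n IH] x xz; first by exists z => //; case.
have [y xy yz] := IH (shift x) xz.
have /cons_point[w w0 wy] : A (letter x 0) (letter y 0) = 1%N.
  by rewrite -(xy 0) //; apply: letter_adm.
exists w; last by rewrite iterSr wy.
by case=> [|k] kn //; rewrite -wy in xy; apply: xy.
Qed.

Lemma graft_path n m x i z : path_of m (letter x n) i -> letter z 0 = i ->
  exists2 y, agree n.+1 x y & iter (n + m) (@shift N A) y = z.
Proof.
move=> p zi; rewrite -zi in p.
have [w w0 wz] := path_point p.
have [y xy yw] := graft (esym w0).
by exists y => //; rewrite addnC iterD yw.
Qed.

Hypothesis h01 : zero_one_mx A.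
Hypothesis hirr : irreducible_mx A.

Lemma mx_pow_path n i j : 0 < (A ^+ n)%R i j -> path_of n i j.
Proof.
elim: n i => [|n IH] i.
  by rewrite expr0 mxE; case: eqP.
rewrite exprS mxE => /lt0n_neq0; rewrite sum_nat_eq0 negb_forall.
move=> /existsP[k]; rewrite muln_eq0 negb_or => /andP[ik kj].
exists k; last by apply: IH; rewrite lt0n.
by case: (h01 i k) ik => -> .
Qed.

Lemma irr_path i j : exists2 n, 0 < n & path_of n i j.
Proof. by have [n n0 /mx_pow_path] := hirr i j; exists n. Qed.

Lemma succ_vertex i : exists k, A i k = 1%N.
Proof. by have [[//|n] _ [k ik _]] := irr_path i i; exists k. Qed.

Lemma point_from i : exists x, letter x 0 = i.
Proof.
have [s sP] := choice succ_vertex.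
have hu n : A (iter n s i) (iter n.+1 s i) = 1%N by apply: sP.
by exists (point_of hu).
Qed.

Lemma pred_vertex j : exists i, A i j = 1%N.
Proof.
(* The predecessor is the last vertex but one of a loop at [j]; the induction frees only the start
   of the path. *)
have [n n0 p] := irr_path j j.
elim: n {1}j n0 p => // -[|n] IH i _ [k ik]; first by move=> <-; exists i.
exact: IH.
Qed.

Lemma shift_surj n x : exists y, iter n (@shift N A) y = x.
Proof.
elim: n x => [|n IH] x; first by exists x.
have [i /cons_point[y _ yx]] := pred_vertex (letter x 0).
by have [z zy] := IH y; exists z; rewrite iterS zy.
Qed.

Hypothesis hperm : ~~ is_perm_mx A.

Lemma not_functional (s : 'I_N -> 'I_N) : injective s ->
  (forall i, A i (s i) = 1%N) -> ~ (forall i j, A i j = 1%N -> j = s i).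
Proof.
move=> sinj As uniq_s; move/negP: hperm; apply.
apply/is_perm_mxP; exists (perm.perm sinj).
apply/matrixP => i j; rewrite !mxE perm.permE.
case: eqP => [<-|sij]; first exact: As.
by case: (h01 i j) => // /uniq_s /esym.
Qed.

(** With unique predecessors any choice of successors is injective, hence bijective on the finite
    alphabet, and [A] would be its permutation matrix. *)
Lemma backward_branching :
  ~ (forall i j k, A i k = 1%N -> A j k = 1%N -> i = j).
Proof.
move=> codet; have [s sP] := choice succ_vertex.
have sinj : injective s by move=> i j e; apply: codet (sP i) _; rewrite e.
apply: (not_functional sinj sP) => i j ij.
have [t st ts] := injF_bij sinj.
by rewrite (codet _ _ _ ij (_ : A (t j) j = 1%N)) ?ts // -{2}(ts j).
Qed.

Lemma forward_branching :
  exists i j k, [/\ A i j = 1%N, A i k = 1%N & j <> k].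
Proof.
apply: contrapT => nb.
have det i j k : A i j = 1%N -> A i k = 1%N -> j = k.
  by move=> ij ik; apply: contrapT => jk; apply: nb; exists i, j, k.
have [s sP] := choice succ_vertex; have [t tP] := choice pred_vertex.
have ts : cancel t s by move=> j; apply: (det (t j)).
have tinj := can_inj ts.
have [u tu ut] := injF_bij tinj.
have su : s =1 u by move=> i; rewrite -{1}(ut i) ts.
apply: (not_functional (s := s)) => //.
  by move=> i j; rewrite !su => /(can_inj ut).
by move=> i j ij; apply: (det i).
Qed.

(* Beyond any prefix a path still reaches a vertex with two successors, and at most
   one of them is compatible with eventual periodicity from time [s] on. *)
Lemma prefix_rigidity x n s t :
  (forall y, agree n x y -> iter s (@shift N A) y = iter t (@shift N A) y) ->
  s = t.
Proof.
wlog st : s t / s < t => [wl h|].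
  have [/wl|ts|//] := ltngtP s t; first exact.
  by apply/esym; apply: wl => // y /h.
move=> h; exfalso; have [b [c [d [bc bd]]]] := forward_branching; apply.
pose m := maxn n t.
have [r _ p] := irr_path (letter x m) b.
have [zc zc0] := point_from c; have [zd zd0] := point_from d.
rewrite -zc0 in bc *; rewrite -zd0 in bd *.
have [bzc bc0 bcE] := cons_point bc; have [bzd bd0 bdE] := cons_point bd.
have [y xy yE] := graft_path p bc0.
pose T := m + r.
have yT : letter y T = letter bzd 0.
  by have := letter_iter y T 0; rewrite yE addn0 bc0 bd0 => ->.
have [w yw wE] := graft yT.
have yT1 : letter y T.+1 = letter zc 0.
  by rewrite -bcE -yE letter_shift letter_iter addn1.
have wT1 : letter w T.+1 = letter zd 0.
  by rewrite -bdE -wE letter_shift letter_iter addn1.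
have nT : maxn n t <= T by rewrite leq_addr.
(* Periodicity reads the letter at [T.+1] off an earlier time, where [y] and [w] coincide, although
   they differ at [T.+1]. *)
have per v : agree n x v -> letter v T.+1 = letter v (T.+1 - (t - s)).
  move=> /h /(congr1 (fun u => letter u (T.+1 - t))); rewrite !letter_iter.
  have -> : t + (T.+1 - t) = T.+1 by lia.
  by have -> : s + (T.+1 - t) = T.+1 - (t - s) by lia.
have xy' : agree n x y by apply: agreeW xy; lia.
have xw : agree n x w by apply: (agree_trans xy') => k kn; apply: yw; lia.
by rewrite -yT1 -wT1 !per //; apply: yw; lia.
Qed.

End Paths.

(** * The period and the cyclic components *)

Section Labels.
Variables (N : nat) (A : 'M[nat]_N).
Implicit Types x y z : shift_space A.

(** The residues of [phi] are the cyclic classes of the graph. The last clause is the form of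
    primitivity within a class that makes tail classes dense in a component. *)
Definition labelling p (phi : 'I_N -> nat) : Prop :=
  [/\ 0 < p,
      forall i j, A i j = 1%N -> phi j = (phi i).+1 %[mod p] &
      forall i j, phi i = phi j %[mod p] ->
        exists n k, path_of A n i k /\ path_of A n j k].

(* [p] is the period of [A]: the least positive difference of the lengths of
   two loops at [v]. *)
Lemma labelling_exists (v : 'I_N) : zero_one_mx A -> irreducible_mx A ->
  exists p phi, labelling p phi.
Proof.
move=> h01 hirr; have irr := irr_path h01 hirr.
pose D d := `[< 0 < d /\ exists m, path_of A m v v /\ path_of A (m + d) v v >].
have exD : exists d, D d.
  by have [n n0 p] := irr v v; exists n; apply/asboolP; split=> //; exists 0.
have [p /asboolP[p0 [m0 [pm0 pm0p]]] pmin] := ex_minnP exD.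
have loops q : exists m, path_of A m v v /\ path_of A (m + q * p) v v.
  elim: q => [|q [m [h1 h2]]]; first by exists 0.
  exists (m0 + m); split; first exact: path_of_cat pm0 h1.
  have -> : m0 + m + q.+1 * p = (m0 + p) + (m + q * p) by lia.
  exact: path_of_cat pm0p h2.
(* A nonzero remainder of [n] modulo [p] would be a smaller difference of two loop lengths, namely
   [m + n] and [m + n %/ p * p]. *)
have loop_dvd n : path_of A n v v -> p %| n.
  move=> pn; apply: contrapT => /negP; rewrite /dvdn -lt0n => r0.
  have : p <= n %% p; last by rewrite leqNgt ltn_mod p0.
  apply: pmin; apply/asboolP; split=> //.
  have [m [h1 h2]] := loops (n %/ p).
  exists (m + n %/ p * p); split=> //.
  by rewrite -addnA -divn_eq; apply: path_of_cat h1 pn.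
have /choice[phi phiP] : forall i, exists n, path_of A n v i.
  by move=> i; have [n _] := irr v i; exists n.
exists p, phi; split=> // [i j ij|i j].
  have [b _ jv] := irr j v.
  have /loop_dvd d1 := path_of_cat (phiP j) jv.
  have /loop_dvd d2 : path_of A (phi i + 1 + b) v v.
    by apply: path_of_cat jv; apply: path_of_cat (phiP i) _; exists j.
  apply/eqP; rewrite -addn1 -(eqn_modDr b) (eqnP d1) //.
  by rewrite (eqnP d2).
have [a _ iv] := irr i v; have [b _ jv] := irr j v.
have da := loop_dvd _ (path_of_cat (phiP i) iv).
have db := loop_dvd _ (path_of_cat (phiP j) jv).
move=> eij.
have {da db eij} : a = b %[mod p].
  apply/eqP; rewrite -(eqn_modDl (phi i)) (eqnP da) -modnDml eij modnDml.
  by rewrite (eqnP db).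
wlog ab : i j a b iv jv / a <= b => [wl eab|].
  have [|ba] := leqP a b; first by move=> ab; apply: (wl i j a b).
  have [n [k [h1 h2]]] := wl j i b a jv iv (ltnW ba) (esym eab).
  by exists n, k.
move=> /esym/eqP; rewrite eqn_mod_dvd // => /dvdnP[q eq].
(* Return paths to [v] from [i] and [j] differ in length by [q * p]; two loops with that same
   difference even them out. *)
have [m [h1 h2]] := loops q.
exists (b + m), v; split; last exact: path_of_cat jv h1.
have -> : b + m = a + (m + q * p) by lia.
exact: path_of_cat iv h2.
Qed.

Variables (p : nat) (phi : 'I_N -> nat).
Hypothesis phiP : labelling p phi.

Definition label x := phi (letter x 0) %% p.

Lemma label_lt x : label x < p.
Proof. by have [p0 _ _] := phiP; rewrite ltn_mod. Qed.

Lemma label_shift x : label (shift x) = (label x).+1 %% p.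
Proof.
have [_ phiS _] := phiP.
by rewrite /label (phiS _ _ (letter_adm x 0)) -[in LHS]addn1 -[in RHS]addn1 modnDml.
Qed.

Lemma label_iter n x : label (iter n (@shift N A) x) = (label x + n) %% p.
Proof.
elim: n => [|n IH]; first by rewrite addn0 modn_small // label_lt.
by rewrite iterS label_shift IH -addn1 modnDml addn1 addnS.
Qed.

Lemma label_tail n x y :
  iter n (@shift N A) x = iter n (@shift N A) y -> label x = label y.
Proof.
move=> /(congr1 label); rewrite !label_iter => /eqP; rewrite eqn_modDr => /eqP.
by rewrite !modn_small ?label_lt.
Qed.

(** Density of tail classes: points with the same label can be altered beyond their first [l]
    letters so that they merge, without changing [F]. *)
Lemma label_invariant T (F : shift_space A -> T) l :
  zero_one_mx A -> irreducible_mx A ->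
  (forall x y, agree l x y -> F x = F y) ->
  (forall n x y, iter n (@shift N A) x = iter n (@shift N A) y -> F x = F y) ->
  forall x y, label x = label y -> F x = F y.
Proof.
move=> h01 hirr Fl Ftail x y xy; have [_ _ phi_path] := phiP.
have : label (iter l (@shift N A) x) = label (iter l (@shift N A) y).
  by rewrite !label_iter xy.
move=> /phi_path[n [k []]]; rewrite !letter_iter !addn0 => px py.
have [z zk] := point_from h01 hirr k.
have [x' xx' x'z] := graft_path px zk; have [y' yy' y'z] := graft_path py zk.
rewrite (Fl x x'); last exact: agreeW xx'.
rewrite (Fl y y'); last exact: agreeW yy'.
by apply: (Ftail (l + n)); rewrite x'z.
Qed.

Lemma label_reach x j : j < p -> exists n, label (iter n (@shift N A) x) = j.
Proof.
move=> jp; exists (p - label x + j); rewrite label_iter addnA.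
by rewrite subnKC ?(ltnW (label_lt x)) // modnDl modn_small.
Qed.

End Labels.

(** * Lags *)

Local Open Scope ring_scope.

Lemma sum_recr (f : nat -> int) n :
  \sum_(0 <= t < n.+1) f t = \sum_(0 <= t < n) f t + f n.
Proof. exact: big_nat_recr. Qed.

Section Lags.
Variables (N : nat) (A : 'M[nat]_N).
Implicit Types x y z : shift_space A.

(* [y] is related to [x] with lag [d] in the Renault-Deaconu groupoid of the
   shift, the number of shifts being bounded by [K]. *)
Definition ulag K (d : int) x y : Prop :=
  exists a b : nat, [/\ (a <= K)%N, (b <= K)%N, a%:Z - b%:Z = d &
    iter a (@shift N A) x = iter b (@shift N A) y].

Lemma ulagW K L d x y : (K <= L)%N -> ulag K d x y -> ulag L d x y.
Proof.
by move=> KL [a [b [aK bK ab e]]]; exists a, b; split=> //; apply: leq_trans KL.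
Qed.

Lemma ulag_refl x : ulag 0 0 x x. Proof. by exists 0%N, 0%N. Qed.

Lemma ulag_sym K d x y : ulag K d x y -> ulag K (- d) y x.
Proof. by move=> [a [b [aK bK <- e]]]; exists b, a; split=> //; rewrite opprB. Qed.

Lemma ulag_trans K L d e x y z :
  ulag K d x y -> ulag L e y z -> ulag (K + L) (d + e) x z.
Proof.
move=> [a [b [aK bK <- xy]]] [a' [b' [aL bL <- yz]]].
exists (a' + a)%N, (b + b')%N; split; try lia.
by rewrite iterD xy -iterD addnC iterD yz -iterD.
Qed.

Lemma ulag_iter n x : ulag n n%:Z x (iter n (@shift N A) x).
Proof. by exists n, 0%N; split=> //; rewrite subr0. Qed.

Lemma ulag0P K x y :
  ulag K 0 x y <-> iter K (@shift N A) x = iter K (@shift N A) y.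
Proof.
split=> [[a [b [aK bK ab e]]]|e]; last by exists K, K; split=> //; rewrite subrr.
have {ab bK}eab : a = b by lia.
by rewrite -(subnK aK) iterD e -eab -iterD.
Qed.

Lemma ulag_nat K n x y : ulag K n%:Z x y ->
  iter (K + n) (@shift N A) x = iter K (@shift N A) y.
Proof.
move=> [a [b [aK bK ab e]]].
have -> : (K + n = (K - b) + a)%N by lia.
by rewrite iterD e -iterD subnK.
Qed.

Lemma ulag_dvd p phi K d x y : labelling A p phi -> ulag K d x y ->
  label p phi x = label p phi y -> (p %| `|d|)%N.
Proof.
move=> phiP [a [b [_ _ <-]]] /(congr1 (label p phi)); rewrite !(label_iter phiP).
move=> + e; rewrite e => /eqP; rewrite eqn_modDl => ab.
have [ba|/ltnW ba] := leqP a b.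
  have -> : `|(a%:Z - b%:Z)|%N = (b - a)%N by lia.
  by rewrite -eqn_mod_dvd // eq_sym.
have -> : `|(a%:Z - b%:Z)|%N = (a - b)%N by lia.
by rewrite -eqn_mod_dvd.
Qed.

(** The pair [(a, b)] may vary with [y], but the bound [K] lets further shifts turn it into the
    fixed pair [(a0 + K, b0 + K)], to which [prefix_rigidity] applies. *)
Lemma ulag_rigid K n d x :
  zero_one_mx A -> irreducible_mx A -> ~~ is_perm_mx A ->
  (forall y, agree n x y -> ulag K d y y) -> d = 0.
Proof.
move=> h01 hirr hperm xd.
have [a0 [b0 [a0K b0K d0 _]]] := xd x (fun k kn => erefl).
suff e : (a0 + K = b0 + K)%N by lia.
apply: (prefix_rigidity h01 hirr hperm (x := x) (n := n)) => y /xd.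
move=> [a [b [aK bK ab e]]].
have -> : (a0 + K = (b0 + K - b) + a)%N by lia.
by rewrite iterD e -iterD subnK //; lia.
Qed.

(** Points of the fibre are determined by their first [n] letters, so the orbit of [x] under [f]
    repeats; by injectivity it returns to [x], and the iterate just before is a preimage. *)
Lemma fiber_surj n (f : shift_space A -> shift_space A) x : injective f ->
  (forall y, iter n (@shift N A) y = iter n (@shift N A) x ->
     iter n (@shift N A) (f y) = iter n (@shift N A) x) ->
  exists2 y, iter n (@shift N A) y = iter n (@shift N A) x & f y = x.
Proof.
move=> finj fx.
have itf k : iter n (@shift N A) (iter k f x) = iter n (@shift N A) x.
  by elim: k => [//|k IH]; apply: fx.
pose pre y := [ffun i : 'I_n => letter y i].
have [i [j [ij eij]]] : exists i j, (i < j)%N /\ iter i f x = iter j f x.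
  apply: contrapT => nij.
  pose T : finType := {ffun 'I_n -> 'I_N}.
  have : injective (fun i : 'I_#|T|.+1 => pre (iter i f x)).
    move=> i j eij; apply/val_inj; apply: contrapT => /eqP ij.
    suff e : iter i f x = iter j f x.
      by apply: nij; move: ij; rewrite neq_ltn => /orP[?|?];
        [exists i, j | exists j, i].
    apply: letter_inj => k; have [kn|nk] := ltnP k n.
      by move/ffunP: eij => /(_ (Ordinal kn)); rewrite !ffunE.
    by rewrite -(subnKC nk) -!letter_iter !itf.
  by move/leq_card; rewrite card_ord ltnn.
have xj : x = iter (j - i) f x.
  have iinj : injective (iter i f) by elim: (i) => [//|k IH] y z /finj /IH.
  by apply: iinj; rewrite -iterD subnKC // ltnW.
exists (iter (j - i).-1 f x) => //.
by rewrite -iterS prednK ?subn_gt0.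
Qed.

End Lags.

(** The tail relation is an increasing union of levels indexed by [n]; each level must be sent into
    a single level. *)
Definition tail_unif N M (A : 'M[nat]_N) (B : 'M[nat]_M)
    (h : shift_space A -> shift_space B) : Prop :=
  forall n, exists m, forall x y,
    iter n (@shift N A) x = iter n (@shift N A) y ->
    iter m (@shift M B) (h x) = iter m (@shift M B) (h y).

(** * Transport of lags by a map *)

Section Transport.
Variables (N M : nat) (A : 'M[nat]_N) (B : 'M[nat]_M).
Implicit Types (h : shift_space A -> shift_space B).

Definition step_lag h K (c : shift_space A -> int) : Prop :=
  forall x, ulag K (c x) (h x) (h (shift x)).

Lemma step_lag_iter h K c n x : step_lag h K c ->
  ulag (n * K) (\sum_(0 <= t < n) c (iter t (@shift N A) x))
    (h x) (h (iter n (@shift N A) x)).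
Proof.
move=> hc; elim: n => [|n IH]; first by rewrite big_geq //; apply: ulag_refl.
rewrite sum_recr mulSn addnC; apply: ulag_trans IH _; exact: hc.
Qed.

(** The potential telescopes along orbits; going [a] steps from [x] and back [b] steps to [y], its
    values at the common point cancel. *)
Lemma potential_lag h K (q : shift_space A -> int) :
  step_lag h K (fun x => 1 + q (shift x) - q x) ->
  forall n d x y, ulag n d x y ->
    ulag (n * K + n * K) (d + q y - q x) (h x) (h y).
Proof.
move=> hq.
have it n x : ulag (n * K) (n%:Z + q (iter n (@shift N A) x) - q x)
    (h x) (h (iter n (@shift N A) x)).
  have -> : n%:Z + q (iter n (@shift N A) x) - q x =
      \sum_(0 <= t < n) (1 + q (shift (iter t (@shift N A) x)) -
        q (iter t (@shift N A) x)).
    elim: n => [|n IH]; first by rewrite big_geq // iter0; lia.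
    by rewrite sum_recr -IH iterS; lia.
  exact: (step_lag_iter _ _ hq).
move=> n d x y [a [b [an bn <- e]]].
have xa := it a x; have := ulag_sym (it b y); rewrite -e => yb.
have := ulag_trans xa yb.
have -> : a%:Z + q (iter a (@shift N A) x) - q x +
  - (b%:Z + q (iter a (@shift N A) x) - q y) = a%:Z - b%:Z + q y - q x by lia.
by apply: ulagW; rewrite leq_add // leq_mul2r ?an ?bn orbT.
Qed.

Hypotheses (hA01 : zero_one_mx A) (hB01 : zero_one_mx B).
Hypotheses (hAirr : irreducible_mx A) (hBirr : irreducible_mx B).

(* If [h] reverses the lag of [n] steps on a tail-invariant set, then following a
   section of [sigma_B^r] and a section of [sigma_A^n] yields an injection that
   preserves the finite fibres of a power of [sigma_A], hence is onto. *)
Lemma backward_lag_injective h (g : shift_space B -> shift_space A)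
    (P : shift_space A -> Prop) K n r :
  cancel h g -> cancel g h -> tail_unif g ->
  (forall l x y, iter l (@shift N A) x = iter l (@shift N A) y -> P x -> P y) ->
  (forall x, P x -> ulag K (- r%:Z) (h x) (h (iter n (@shift N A) x))) ->
  forall x y, P x -> P y ->
    iter n (@shift N A) x = iter n (@shift N A) y -> x = y.
Proof.
move=> hK gK gtail Ptail Plag.
have /choice[sA sAP] := shift_surj hA01 hAirr n.
have /choice[sB sBP] := shift_surj hB01 hBirr r.
pose f x := sA (g (sB (h x))).
have finj : injective f.
  exact: inj_comp (can_inj sAP) (inj_comp (can_inj gK)
    (inj_comp (can_inj sBP) (can_inj hK))).
have [m gm] := gtail (r + K)%N.
have ftail x : P x -> iter (m + n) (@shift N A) (f x) = iter (m + n) (@shift N A) x.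
  move=> Px; rewrite !iterD /f sAP.
  rewrite -(hK (iter n (@shift N A) x)); apply: gm; apply/ulag0P.
  (* The [r] steps from [sB (h x)] to [h x] cancel the lag [- r], so [sB (h x)] is tail equivalent
     to the image of [iter n x]. *)
  have := ulag_iter r (sB (h x)); rewrite sBP => l1.
  by have := ulag_trans l1 (Plag _ Px); rewrite subrr.
have fsurj x : P x -> exists2 y, P y & f y = x.
  move=> Px; have tailP y (yx : iter (m + n) (@shift N A) y =
      iter (m + n) (@shift N A) x) : P y by exact: Ptail (esym yx) Px.
  have [y yx|y yx fy] := @fiber_surj _ _ (m + n) f x finj.
    by rewrite ftail //; apply: tailP.
  by exists y => //; apply: tailP.
move=> _ _ /fsurj[x _ <-] /fsurj[y _ <-]; rewrite /f !sAP => e.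
by rewrite e.
Qed.

End Transport.

(** * Exchanging consecutive components *)

Section Homeos.
Variables (N M : nat) (A : 'M[nat]_N) (B : 'M[nat]_M).

Lemma homeo_of (f : shift_space A -> shift_space B) g :
  cancel f g -> cancel g f -> unif_cont f -> unif_cont g ->
  exists h : homeo (shift_space A) (shift_space B),
    homeo_fun h = f /\ homeo_inv h = g.
Proof.
move=> fK gK /unif_contP cf /unif_contP cg.
by exists (Homeo fK gK cf cg).
Qed.

Lemma homeo_unif (h : homeo (shift_space A) (shift_space B)) : unif_cont h.
Proof. exact/unif_contP/homeo_fun_continuous. Qed.

Lemma homeo_inv_unif (h : homeo (shift_space A) (shift_space B)) :
  unif_cont (homeo_inv h).
Proof. exact/unif_contP/homeo_inv_continuous. Qed.

End Homeos.

Lemma unif_cont_comp N M P (A : 'M[nat]_N) (B : 'M[nat]_M) (C : 'M[nat]_P)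
    (f : shift_space A -> shift_space B) (g : shift_space B -> shift_space C) :
  unif_cont f -> unif_cont g -> unif_cont (g \o f).
Proof.
move=> uf ug n; have [m gm] := ug n; have [k fk] := uf m.
by exists k => x y /fk/gm.
Qed.

Lemma tail_unif_comp N M P (A : 'M[nat]_N) (B : 'M[nat]_M) (C : 'M[nat]_P)
    (f : shift_space A -> shift_space B) (g : shift_space B -> shift_space C) :
  tail_unif f -> tail_unif g -> tail_unif (g \o f).
Proof.
move=> uf ug n; have [m fm] := uf n; have [k gk] := ug m.
by exists k => x y /fm/gk.
Qed.

Lemma homeo_comp N M P (A : 'M[nat]_N) (B : 'M[nat]_M) (C : 'M[nat]_P)
    (f : homeo (shift_space A) (shift_space B))
    (g : homeo (shift_space B) (shift_space C)) :
  exists h : homeo (shift_space A) (shift_space C),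
    homeo_fun h = g \o f /\ homeo_inv h = homeo_inv f \o homeo_inv g.
Proof.
apply: homeo_of.
- exact: can_comp (homeo_funK g) (homeo_funK f).
- exact: can_comp (homeo_invK f) (homeo_invK g).
- exact: unif_cont_comp (homeo_unif f) (homeo_unif g).
- exact: unif_cont_comp (homeo_inv_unif g) (homeo_inv_unif f).
Qed.

Lemma homeo_opp N M (A : 'M[nat]_N) (B : 'M[nat]_M)
    (f : homeo (shift_space A) (shift_space B)) :
  exists h : homeo (shift_space B) (shift_space A),
    homeo_fun h = homeo_inv f /\ homeo_inv h = f.
Proof.
by exists (Homeo (homeo_invK f) (homeo_funK f) (@homeo_inv_continuous _ _ f)
  (@homeo_fun_continuous _ _ f)).
Qed.

(** The lag from [f x] to [f (shift x)] is [- t x + 1 + t (shift x)]; transporting it by [h]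
    replaces [q] by [q \o f + t]. *)
Lemma potential_comp N M (A : 'M[nat]_N) (B : 'M[nat]_M)
    (h : shift_space A -> shift_space B) (f : shift_space A -> shift_space A)
    K L (q t : shift_space A -> int) :
  step_lag h K (fun x => 1 + q (shift x) - q x) ->
  (forall x, ulag L (t x) x (f x)) ->
  exists K', step_lag (h \o f) K'
    (fun x => 1 + (q (f (shift x)) + t (shift x)) - (q (f x) + t x)).
Proof.
move=> hq ft; exists ((L + 1 + L) * K + (L + 1 + L) * K)%N => x.
have := ulag_trans (ulag_trans (ulag_sym (ft x)) (ulag_iter 1 x)) (ft (shift x)).
move=> /(potential_lag hq).
by congr ulag; rewrite /=; lia.
Qed.

Section Swap.
Variables (N : nat) (A : 'M[nat]_N) (p : nat) (phi : 'I_N -> nat).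
Hypotheses (h01 : zero_one_mx A) (hirr : irreducible_mx A).
Hypothesis phiP : labelling A p phi.
Implicit Types x y : shift_space A.
Local Notation lab := (label p phi).

Lemma label_agree x y : agree 1 x y -> lab x = lab y.
Proof. by rewrite /label => ->. Qed.

Lemma label_swap i : (i < p)%N -> (i.+1 %% p)%N != i ->
  (forall x y, lab x = i -> lab y = i -> shift x = shift y -> x = y) ->
  exists f : homeo (shift_space A) (shift_space A),
  [/\ homeo_inv f = f,
      forall x, lab x = i -> f x = shift x,
      forall x, lab x = (i.+1 %% p)%N -> lab (f x) = i /\ shift (f x) = x &
      forall x, lab x <> i -> lab x <> (i.+1 %% p)%N -> f x = x].
Proof.
move=> ip /eqP ii sinj.
have [prec precP] := choice (shift_surj h01 hirr 1).
have {}precP x : shift (prec x) = x by exact: precP.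
have lab_prec x : lab x = (i.+1 %% p)%N -> lab (prec x) = i.
  rewrite -[in lab x](precP x) (label_shift phiP) -addn1 -[in RHS]addn1 => /eqP.
  by rewrite eqn_modDr => /eqP; rewrite !modn_small ?label_lt.
pose f x := if lab x == i then shift x else
  if lab x == (i.+1 %% p)%N then prec x else x.
have f1 x : lab x = i -> f x = shift x by rewrite /f => ->; rewrite eqxx.
have f2 x : lab x = (i.+1 %% p)%N -> f x = prec x.
  by rewrite /f => ->; rewrite eqxx (introF eqP ii).
have f3 x : lab x <> i -> lab x <> (i.+1 %% p)%N -> f x = x.
  by rewrite /f => /eqP/negPf-> /eqP/negPf->.
have fK : cancel f f.
  move=> x; have [xi|xi] := eqVneq (lab x) i.
    have sxi : lab (shift x) = (i.+1 %% p)%N by rewrite (label_shift phiP) xi.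
    by rewrite (f1 x) // f2 //; apply: sinj; rewrite ?lab_prec ?precP.
  have [xj|xj] := eqVneq (lab x) (i.+1 %% p)%N.
    by rewrite (f2 x) // f1 ?lab_prec ?precP.
  by rewrite (f3 x) ?f3 //; apply/eqP.
have fu : unif_cont f.
  move=> n; exists n.+1 => x y xy.
  have xy0 : lab x = lab y by apply: label_agree; apply: agreeW xy.
  rewrite /f -xy0; case: eqP => _.
    by move=> k kn; rewrite !letter_shift xy.
  case: eqP => [xi|_]; last exact: agreeW xy.
  move=> [|k] kn; last first.
    by rewrite -!letter_shift !precP xy // ltnW // ltnW.
  (* Putting the first letter of [prec y] before [x] gives a preimage of [x] in component [i], which
     is [prec x] by injectivity; so the two first letters agree. *)
  have /cons_point[z z0 zx] : A (letter (prec y) 0) (letter x 0) = 1%N.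
    by rewrite xy // -{2}(precP y) letter_shift letter_adm.
  rewrite -z0; congr letter; apply: sinj; rewrite ?zx ?precP ?lab_prec //.
  by rewrite /label z0 -[LHS]/(lab (prec y)) lab_prec // -xy0.
have [h [hf hg]] := homeo_of fK fK fu fu.
exists h; rewrite hf hg; split=> // x xi.
by rewrite f2 // precP lab_prec.
Qed.

End Swap.

(** The sum of squares drops by [2 * (a - b - 1)]. *)
Lemma sqr_swap_lt (a b s : int) (n : nat) : b + 1 < a ->
  a ^+ 2 + b ^+ 2 + s < n.+1%:Z -> (b + 1) ^+ 2 + (a - 1) ^+ 2 + s < n%:Z.
Proof.
rewrite sqrrD1 sqrrB1 !mulr2n.
by move: (a ^+ 2) (b ^+ 2) => a2 b2; lia.
Qed.

(** * Sorting the potential *)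

Section Straighten.
Variables (N M : nat) (A : 'M[nat]_N) (B : 'M[nat]_M) (p : nat).
Variables (phi : 'I_N -> nat) (v : 'I_N).
Hypotheses (hA01 : zero_one_mx A) (hB01 : zero_one_mx B).
Hypotheses (hAirr : irreducible_mx A) (hBirr : irreducible_mx B).
Hypothesis (hAperm : ~~ is_perm_mx A).
Hypothesis phiP : labelling A p phi.
Implicit Types (x y : shift_space A) (q : shift_space A -> int).
Local Notation lab := (label p phi).
Local Notation sA := (@shift N A).

(** After [p] steps the label, and with it [q], is back at its initial value. *)
Lemma label_monotone_const q :
  (forall x y, lab x = lab y -> q x = q y) ->
  (forall x, q x <= q (shift x)) -> forall x, q (shift x) = q x.
Proof.
move=> qlab qmon x; apply/le_anti; rewrite qmon andbT.
have mon n y : q y <= q (iter n sA y).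
  by elim: n => [//|n IH]; apply: le_trans IH _; rewrite iterS.
have [p0 _ _] := phiP.
rewrite (qlab x (iter p.-1 sA (shift x))) //.
by rewrite -iterSr prednK // (label_iter phiP) modnDr modn_small ?label_lt.
Qed.

(** On the component of [x] the lag is constant and at most 0. Lag 0 would make [y] and [shift y]
    tail equivalent on a cylinder, against rigidity; a negative lag calls for
    [backward_lag_injective]. *)
Lemma descent_label_injective h K (g : shift_space B -> shift_space A) q x :
  cancel h g -> cancel g h -> tail_unif g ->
  (forall x y, lab x = lab y -> q x = q y) ->
  step_lag h K (fun x => 1 + q (shift x) - q x) -> q (shift x) < q x ->
  q (shift x) + 1 < q x /\
  forall y z, lab y = lab x -> lab z = lab x -> shift y = shift z -> y = z.
Proof.
move=> hK gK gtail qlab hq qx.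
have lagx y : lab y = lab x -> 1 + q (shift y) - q y = 1 + q (shift x) - q x.
  move=> yx; rewrite (qlab y x) // (qlab (shift y) (shift x)) //.
  by rewrite !(label_shift phiP) yx.
have qx1 : 1 + q (shift x) - q x != 0.
  apply/eqP => e0.
  have [m gm] := gtail K.
  have : (-1 : int) = 0; last by [].
  apply: (ulag_rigid (K := (m + 1)%N) (n := 1%N) (x := x) hA01 hAirr hAperm) => y xy.
  have := hq y; rewrite lagx ?e0; last first.
    by apply/esym; apply: (label_agree p phi xy).
  move=> /ulag0P/gm; rewrite !hK => /ulag0P h1.
  by have := ulag_trans h1 (ulag_sym (ulag_iter 1 y)); rewrite add0r.
split; first by lia.
have [r er] : exists r : nat, 1 + q (shift x) - q x = - r%:Z.
  by exists `|(1 + q (shift x) - q x)%R|%N; lia.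
apply: (backward_lag_injective hA01 hB01 hAirr hBirr (K := K) (n := 1)
  (r := r) (h := h) (P := fun y => lab y = lab x) hK gK gtail).
  by move=> l y z /(label_tail phiP) ->.
by move=> y /lagx yx; have := hq y; rewrite yx er.
Qed.

Definition unit_lag (h : homeo (shift_space A) (shift_space B)) : Prop :=
  [/\ tail_unif h, tail_unif (homeo_inv h) & exists K, step_lag h K (fun=> 1)].

(* The potential is sorted by exchanging consecutive components [i], [i + 1] on
   which it drops; the sum of its squares over the components decreases. *)
Lemma straighten (h : homeo (shift_space A) (shift_space B)) K q :
  tail_unif h -> tail_unif (homeo_inv h) ->
  (forall x y, lab x = lab y -> q x = q y) ->
  step_lag h K (fun x => 1 + q (shift x) - q x) ->
  exists h', unit_lag h'.
Proof.
have [p0 _ _] := phiP.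
have /choice[rep repP] : forall j : 'I_p, exists x, lab x = j.
  move=> j; have [x _] := point_from hA01 hAirr v.
  by have [n xj] := label_reach phiP x (ltn_ord j); exists (iter n sA x).
pose mu q := \sum_(j < p) q (rep j) ^+ 2.
have [n] : exists n : nat, mu q < n%:Z.
  by exists `|mu q|%N.+1; lia.
elim: n h K q => [|n IH] h K q qn hT gT qlab hq.
  by have : 0 <= mu q; [apply: sumr_ge0 => j _; apply: sqr_ge0 | lia].
have [qmon|/existsNP[x /negP]] := pselect (forall x, q x <= q (shift x)).
  exists h; split=> //; exists K => x.
  by have := hq x; rewrite (label_monotone_const qlab qmon) addrK.
rewrite -ltNge => qx.
have [qx1 sinj] :=
  descent_label_injective (@homeo_funK _ _ h) (@homeo_invK _ _ h) gT qlab hq qx.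
pose i := lab x; pose i' := (i.+1 %% p)%N.
have labsx : lab (shift x) = i' by rewrite (label_shift phiP).
have ii : i' != i.
  by apply/eqP => e; move: qx; rewrite (qlab (shift x) x) ?ltxx // labsx.
have [f [ff f1 f2 f3]] := label_swap hA01 hAirr phiP (label_lt phiP x) ii sinj.
(* [f] shifts forward on component [i] and backward on component [i']. *)
pose t y : int := if lab y == i then 1 else if lab y == i' then -1 else 0.
have ft y : ulag 1 (t y) y (f y).
  rewrite /t; case: eqP => [yi|yi]; first by rewrite f1 //; apply: (ulag_iter 1).
  case: eqP => [yj|yj]; last by rewrite f3 //; apply: ulagW (ulag_refl _).
  by have [_ {1}<-] := f2 _ yj; apply/ulag_sym; apply: (ulag_iter 1).
have fT : tail_unif f.
  move=> k; exists k.+1 => y z yz; have lyz := label_tail phiP yz.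
  have [yi|yi] := eqVneq (lab y) i.
    by rewrite !f1 -?lyz // -!iterSr !iterS yz.
  have [yj|yj] := eqVneq (lab y) i'.
    have [_ e1] := f2 _ yj; have [_ e2] : lab (f z) = i /\ shift (f z) = z.
      by apply: f2; rewrite -lyz.
    by rewrite !iterSr e1 e2.
  by rewrite !f3 -?lyz ?iterS ?yz //; apply/eqP.
have [h' [h'E g'E]] := homeo_comp f h.
have [K' hq'] := potential_comp hq ft.
pose q' y := q (f y) + t y.
have lf y z : lab y = lab z -> lab (f y) = lab (f z).
  move=> yz; have [yi|yi] := eqVneq (lab y) i.
    by rewrite !f1 -?yz // !(label_shift phiP) yz.
  have [yj|yj] := eqVneq (lab y) i'.
    by have [-> _] := f2 _ yj; have [|-> _] := f2 z; rewrite -?yz.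
  by rewrite !f3 -?yz //; apply/eqP.
apply: (IH h' K' q').
- have o : (i < p)%N /\ (i' < p)%N by rewrite label_lt // ltn_mod.
  pose j := Ordinal o.1; pose j' := Ordinal o.2.
  have jj : j' != j by [].
  have qj : q x = q (rep j) by apply: qlab; rewrite repP.
  have qj' : q (shift x) = q (rep j') by apply: qlab; rewrite repP.
  (* The exchange swaps the two values and moves each one unit towards the other, as in
     [sqr_swap_lt]. *)
  have q'j : q' (rep j) = q (shift x) + 1.
    rewrite /q' /t repP eqxx; congr (_ + _); apply: qlab.
    by rewrite f1 ?repP // (label_shift phiP) repP.
  have q'j' : q' (rep j') = q x - 1.
    rewrite /q' /t repP eqxx (negPf ii); congr (_ + _); apply: qlab.
    by have [|-> _] := f2 (rep j'); rewrite ?repP.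
  have split2 (F : 'I_p -> int) : \sum_k F k =
      F j + F j' + \sum_(k | (k != j) && (k != j')) F k.
    by rewrite (bigD1 j) //= (bigD1 j') //= addrA.
  have -> : mu q' = (q (shift x) + 1) ^+ 2 + (q x - 1) ^+ 2 +
      \sum_(k | (k != j) && (k != j')) q (rep k) ^+ 2.
    rewrite /mu split2 q'j q'j'; congr (_ + _); apply: eq_bigr.
    move=> k /andP[kj kj']; congr (_ ^+ 2).
    rewrite /q' /t repP f3 ?repP //; try exact/eqP.
    by rewrite (negPf (kj : val k != i)) (negPf (kj' : val k != i')) addr0.
  move: qn; rewrite /mu split2 -qj -qj'.
  exact: sqr_swap_lt.
- by rewrite h'E; apply: tail_unif_comp.
- by rewrite g'E ff; apply: tail_unif_comp.
- move=> y z yz; rewrite /q' /t yz; congr (_ + _); apply: qlab.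
  exact: lf.
- by rewrite h'E.
Qed.

End Straighten.

(** * The cocycle of a tail-preserving homeomorphism *)

Section Components.
Variables (N : nat) (A : 'M[nat]_N) (p : nat) (phi : 'I_N -> nat).
Hypothesis phiP : labelling A p phi.
Local Notation lab := (label p phi).
Local Notation sA := (@shift N A).

Lemma label_invariant_const T (F : shift_space A -> T) :
  (forall x y, lab x = lab y -> F x = F y) ->
  (forall x, F (shift x) = F x) -> forall x y, F x = F y.
Proof.
move=> Flab Fshift x y; have [n /Flab <-] := label_reach phiP x (label_lt phiP y).
by elim: n => [//|n ->]; rewrite iterS Fshift.
Qed.

(** Shifting the window trades the term at [x] for the one at [iter p sA x], which has the same
    label. *)
Lemma period_sum_const (c : shift_space A -> int) :
  (forall x y, lab x = lab y -> c x = c y) -> forall x y,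
  \sum_(0 <= t < p) c (iter t sA x) = \sum_(0 <= t < p) c (iter t sA y).
Proof.
move=> clab; apply: label_invariant_const => [x y xy|x].
  by apply: eq_bigr => t _; apply: clab; rewrite !(label_iter phiP) xy.
have : \sum_(0 <= t < p.+1) c (iter t sA x) = \sum_(0 <= t < p.+1) c (iter t sA x).
  by [].
rewrite {1}sum_recr (clab (iter p sA x) x); last first.
  by rewrite (label_iter phiP) modnDr modn_small ?label_lt.
rewrite big_nat_recl // addrC => /addrI e; rewrite [RHS]e.
by apply: eq_bigr => t _; rewrite iterSr.
Qed.

(** [q] sums [c - 1] from component 0 up to that of [x]; it closes up at the last component because
    [c - 1] has sum zero over a period. *)
Lemma potential_exists (c : shift_space A -> int) (x0 : shift_space A) :
  (forall x y, lab x = lab y -> c x = c y) ->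
  (forall x, \sum_(0 <= t < p) c (iter t sA x) = p%:Z) ->
  exists q : shift_space A -> int, (forall x y, lab x = lab y -> q x = q y) /\
    forall x, c x = 1 + q (shift x) - q x.
Proof.
move=> clab csum; have [p0 _ _] := phiP.
have [n xn] := label_reach phiP x0 p0; move: {x0 n}(iter n sA x0) xn => x0 x00.
exists (fun x => \sum_(0 <= j < lab x) (c (iter j sA x0) - 1)).
split=> [x y ->//|x].
have cx : c x = c (iter (lab x) sA x0).
  by apply: clab; rewrite (label_iter phiP) x00 add0n modn_small ?label_lt.
rewrite cx (label_shift phiP); have := label_lt phiP x; move: (lab x) => l.
rewrite leq_eqVlt => /predU1P[lp|lp].
  rewrite lp modnn big_geq //.
  have := csum x0; rewrite -lp sum_recr sumrB sumr_const_nat subn0 -natz.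
  by move: (\sum_(0 <= i < l) c (iter i sA x0)); lia.
by rewrite modn_small // sum_recr; lia.
Qed.

End Components.

Section Cocycle.
Variables (N M : nat) (A : 'M[nat]_N) (B : 'M[nat]_M).
Hypotheses (hA01 : zero_one_mx A) (hB01 : zero_one_mx B).
Hypotheses (hAirr : irreducible_mx A) (hBirr : irreducible_mx B).
Hypotheses (hBperm : ~~ is_perm_mx B).
Variable h : homeo (shift_space A) (shift_space B).
Local Notation sA := (@shift N A).
Local Notation sB := (@shift M B).

Lemma homeo_ulag_rigid K n d x :
  (forall y, agree n x y -> ulag K d (h y) (h y)) -> d = 0.
Proof.
move=> hd; have [m gm] := homeo_inv_unif h n.
apply: (ulag_rigid (n := m) (x := h x) (K := K) hB01 hBirr hBperm) => w /gm.
by rewrite homeo_funK => /hd; rewrite homeo_invK.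
Qed.

(* Lags are ambiguous at eventually periodic points only, so tail equivalent points
   with distinct values of [c] would have neighbourhoods made of such points. *)
Lemma step_lag_tail K (c : shift_space A -> int) l : tail_unif h ->
  step_lag h K c -> (forall x y, agree l x y -> c x = c y) ->
  forall n x y, iter n sA x = iter n sA y -> c x = c y.
Proof.
move=> hT hc cl n x y xy; have [m hm] := hT n.
apply/eqP; rewrite -subr_eq0; apply/eqP.
apply: (@homeo_ulag_rigid (K + m + K + m) (n + l).+1 _ x) => x' xx'.
have yx' : letter y n = letter (iter n sA x') 0.
  by rewrite letter_iter addn0 -xx' ?ltnS ?leq_addr // -[n]addn0 -!letter_iter xy.
(* [y'] follows [y] up to time [n] and [x'] afterwards. Going through [h (shift x')], [h (shift y')]
   and [h y'] then makes a loop at [h x'] of lag [c x' - c y']. *)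
have [y' yy' y'x'] := graft yx'.
have yl : agree l y y'.
  move=> k kl; have [kn|/ltnW nk] := leqP k n; first exact: yy'.
  rewrite -(subnKC nk) -!letter_iter y'x' -xy !letter_iter; apply: xx'; lia.
rewrite (cl x x'); last by apply: agreeW xx'; lia.
rewrite (cl y y') //.
have h1 : ulag m 0 (h (shift x')) (h (shift y')).
  by apply/ulag0P; apply: hm; rewrite -!iterSr !iterS y'x'.
have h2 : ulag m 0 (h y') (h x') by apply/ulag0P; apply: hm.
have := ulag_trans (ulag_trans (ulag_trans (hc x') h1) (ulag_sym (hc y'))) h2.
by rewrite !addr0.
Qed.

Lemma homeo_label p phi p' phi' : labelling A p phi -> labelling B p' phi' ->
  tail_unif h -> forall x y, label p phi x = label p phi y ->
  label p' phi' (h x) = label p' phi' (h y).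
Proof.
move=> phiP phiP' hT; have [l hl] := homeo_unif h 1.
apply: (label_invariant phiP (l := l)) => // [x y /hl|n x y xy].
  exact: label_agree.
by have [m /(_ _ _ xy)/(label_tail phiP')] := hT n.
Qed.

Lemma iter_period_lag K p s :
  (forall x, ulag K s (h x) (h (iter p sA x))) ->
  forall n x, ulag (n * K) (n%:Z * s) (h x) (h (iter (n * p) sA x)).
Proof.
move=> hs; elim=> [|n IH] x; first by rewrite mul0r; apply: ulag_refl.
have := ulag_trans (IH x) (hs (iter (n * p) sA x)).
by rewrite -iterD -mulSn addnC -mulSn intS mulrDl mul1r addrC.
Qed.

(** A lag [n * p] with [n] nonnegative is [n] periods, each of lag [s] under [h], followed by a tail
    equivalence; negative [n] follows by symmetry. *)
Lemma period_lag_transport K p s : tail_unif h ->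
  (forall x, ulag K s (h x) (h (iter p sA x))) ->
  forall (n : int) L, exists L', forall x y,
    ulag L (n * p%:Z) x y -> ulag L' (n * s) (h x) (h y).
Proof.
move=> hT hs.
have pos (n : nat) L : exists L', forall x y,
    ulag L (n%:Z * p%:Z) x y -> ulag L' (n%:Z * s) (h x) (h y).
  have [m hm] := hT L; exists (n * K + m)%N => x y.
  rewrite -PoszM => /ulag_nat; rewrite iterD => /hm /ulag0P.
  by move=> /(ulag_trans (iter_period_lag hs n x)); rewrite addr0.
move=> [n|n] L; first exact: pos.
have [L' hL'] := pos n.+1 L; exists L' => x y /ulag_sym.
rewrite NegzE !mulNr opprK => /hL' /ulag_sym; exact.
Qed.

End Cocycle.

(** [h] sends the components injectively to components, because its inverse respects labels. *)
Lemma homeo_period_leq N M (A : 'M[nat]_N) (B : 'M[nat]_M)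
    (h : homeo (shift_space A) (shift_space B)) p phi p' phi'
    (x0 : shift_space A) :
  zero_one_mx B -> irreducible_mx B ->
  labelling A p phi -> labelling B p' phi' -> tail_unif (homeo_inv h) ->
  (p <= p')%N.
Proof.
move=> hB01 hBirr phiP phiP' gT; have [g [gE _]] := homeo_opp h.
have /choice[rep repP] : forall j : 'I_p, exists x : shift_space A,
    label p phi x = j.
  move=> j; have [n xj] := label_reach phiP x0 (ltn_ord j).
  by exists (iter n (@shift N A) x0).
suff /leq_card : injective (fun j => Ordinal (label_lt phiP' (h (rep j)))).
  by rewrite !card_ord.
move=> i j /(congr1 val) /= e; apply: val_inj; rewrite /= -(repP i) -(repP j).
have := homeo_label (h := g) hB01 hBirr phiP' phiP _ e.
by rewrite gE !homeo_funK; apply.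
Qed.

Lemma shift_not_injective N (A : 'M[nat]_N) :
  zero_one_mx A -> irreducible_mx A -> ~~ is_perm_mx A ->
  ~ injective (@shift N A).
Proof.
move=> h01 hirr hperm sinj; apply: (backward_branching h01 hirr hperm) => i j k.
have [z <-] := point_from h01 hirr k.
move=> /cons_point[x <- xz] /cons_point[y <- yz].
by rewrite (sinj x y) // xz.
Qed.

(** * The sum of the cocycle over a period *)

Section PeriodSum.
Variables (N M : nat) (A : 'M[nat]_N) (B : 'M[nat]_M).
Hypotheses (hA01 : zero_one_mx A) (hB01 : zero_one_mx B).
Hypotheses (hAirr : irreducible_mx A) (hBirr : irreducible_mx B).
Hypotheses (hAperm : ~~ is_perm_mx A) (hBperm : ~~ is_perm_mx B).
Variable h : homeo (shift_space A) (shift_space B).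
Hypotheses (hT : tail_unif h) (gT : tail_unif (homeo_inv h)).
Variables (p p' : nat) (phi : 'I_N -> nat) (phi' : 'I_M -> nat).
Hypotheses (phiP : labelling A p phi) (phiP' : labelling B p' phi').
Variable x0 : shift_space A.
Local Notation sA := (@shift N A).
Local Notation sB := (@shift M B).

Lemma period_lag_dvd K s :
  (forall x, ulag K s (h x) (h (iter p sA x))) -> exists n : int, s = n * p'%:Z.
Proof.
move=> hs; apply/intdiv.dvdzP; rewrite /intdiv.dvdz.
apply: (ulag_dvd phiP' (hs x0)); apply: (homeo_label hA01 hAirr phiP phiP' hT).
by rewrite (label_iter phiP) modnDr modn_small ?label_lt.
Qed.

Lemma period_lag_eq K K' s s' :
  (forall x, ulag K s (h x) (h (iter p sA x))) ->
  (forall w, ulag K' s' (homeo_inv h w) (homeo_inv h (iter p' sB w))) ->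
  (exists n : int, s' = n * p%:Z) ->
  s = p%:Z.
Proof.
move=> hs gs [n' s'E]; have [n sE] := period_lag_dvd hs.
have [p0 _ _] := phiP.
have [g [gE gI]] := homeo_opp h.
have pp' : p = p'.
  apply/eqP; rewrite eqn_leq (homeo_period_leq (h := h) x0 _ _ phiP phiP') //.
  by rewrite (homeo_period_leq (h := g) (h x0) _ _ phiP' phiP) ?gI.
(* Carrying the lag [s = n * p'] back by the inverse gives lag [n * s'] from [y] to [iter p sA y];
   rigidity compares it with [p]. *)
have ns : n * s' = p%:Z.
  have [L gL] : exists L, forall w w',
      ulag K (n * p'%:Z) w w' -> ulag L (n * s') (g w) (g w').
    by apply: (period_lag_transport (K := K') (h := g)); rewrite gE.
  apply/eqP; rewrite -subr_eq0; apply/eqP.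
  apply: (ulag_rigid (K := L + p) (n := 0) (x := x0) hA01 hAirr hAperm) => y _.
  have := hs y; rewrite sE => /gL; rewrite gE !homeo_funK => l1.
  exact: ulag_trans l1 (ulag_sym (ulag_iter p y)).
have nn' : n * n' = 1.
  by apply: (mulIf (_ : p%:Z != 0)); [lia | rewrite -mulrA -s'E ns mul1r].
have [n1|n1] : n = 1 \/ n = -1.
  have /eqP : (`|n| * `|n'| = 1)%N by rewrite -abszM nn'.
  by rewrite muln_eq1 => /andP[/eqP + _]; lia.
  by rewrite sE n1 mul1r pp'.
(* If [n = -1], then [h] reverses whole periods, so [iter p sA], and hence the shift, would be
   injective. *)
exfalso; apply: (shift_not_injective hA01 hAirr hAperm) => x y xy.
apply: (backward_lag_injective hA01 hB01 hAirr hBirr (P := fun=> True)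
  (K := K) (r := p') (n := p) (@homeo_funK _ _ h) (@homeo_invK _ _ h)) => //.
  by move=> z _; rewrite -mulN1r -n1 -sE.
by rewrite -(prednK p0) !iterSr xy.
Qed.

End PeriodSum.

(** * The equivalences *)

Section CylinderSwap.
Variables (N : nat) (A : 'M[nat]_N).
Implicit Types x y z w : shift_space A.
Local Notation sA := (@shift N A).

Lemma agree_tail n m x y z w :
  iter n sA z = iter n sA x -> iter n sA w = iter n sA y ->
  agree n z w -> agree m x y -> agree m z w.
Proof.
move=> zx wy zw xy k km; have [/zw//|nk] := ltnP k n.
by rewrite -(subnKC nk) -!letter_iter zx wy !letter_iter subnKC // xy.
Qed.

Lemma agree_tail_eq n x y : agree n x y -> iter n sA x = iter n sA y -> x = y.
Proof.
move=> xy e; apply: letter_inj => k.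
exact: (agree_tail e erefl xy (m := k.+1)).
Qed.

Lemma graft_agree n x z : letter x n = letter z n ->
  exists2 w, agree n.+1 x w & iter n sA w = iter n sA z.
Proof.
move=> xz; have [|w xw wz] := @graft _ _ n x (iter n sA z).
  by rewrite letter_iter addn0.
by exists w.
Qed.

(** [f] exchanges the prefixes of [x] and [y] of length [n.+1] and keeps the tail; this is
    admissible since both prefixes end in the same letter. *)
Lemma cylinder_swap n x y : iter n sA x = iter n sA y ->
  exists2 f : homeo (shift_space A) (shift_space A), AF_full_group (A := A) f &
    forall z w, agree n.+1 x z -> agree n.+1 y w -> iter n sA z = iter n sA w ->
      f z = w.
Proof.
move=> exy.
have xyn : letter x n = letter y n.
  by have := congr1 (fun u => letter u 0) exy; rewrite !letter_iter !addn0.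
have /choice[f fP] : forall z, exists w, [/\ iter n sA w = iter n sA z,
    agree n.+1 x z -> agree n.+1 y w,
    ~ agree n.+1 x z -> agree n.+1 y z -> agree n.+1 x w &
    ~ agree n.+1 x z -> ~ agree n.+1 y z -> w = z].
  move=> z; have [xz|xz] := pselect (agree n.+1 x z).
    have [w yw wz] := @graft_agree n y z (etrans (esym xyn) (xz n (ltnSn n))).
    by exists w.
  have [yz|yz] := pselect (agree n.+1 y z); last by exists z.
  have [w yw wz] := @graft_agree n x z (etrans xyn (yz n (ltnSn n))).
  by exists w.
have prefix_eq v z w : agree n.+1 v z -> agree n.+1 v w -> agree n z w.
  by move=> vz vw k kn; rewrite -vz ?vw // ltnW.
have fK : cancel f f.
  move=> z; have [e1 a1 b1 c1] := fP z; have [e2 a2 b2 c2] := fP (f z).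
  have e : iter n sA (f (f z)) = iter n sA z by rewrite e2.
  apply: agree_tail_eq e.
  have [xz|xz] := pselect (agree n.+1 x z).
    (* [f z] lies in the cylinder of [y]; if it also lies in that of [x], the two cylinders
       coincide. *)
    have [xf|xf] := pselect (agree n.+1 x (f z)).
      apply: prefix_eq (a2 xf) _ => k kn.
      by rewrite (a1 xz) // -xf // xz.
    by apply: (prefix_eq x) => //; apply: b2 => //; apply: a1.
  have [yz|yz] := pselect (agree n.+1 y z).
    by apply: (prefix_eq y) => //; apply: a2; apply: b1.
  by rewrite c1 in c2 *; rewrite ?c2.
have fu : unif_cont f.
  move=> m; exists (m + n.+1)%N => z w zw.
  have [e1 a1 b1 c1] := fP z; have [e2 a2 b2 c2] := fP w.
  have zwn : agree n.+1 z w by apply: agreeW zw; lia.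
  have tr v : agree n.+1 v z <-> agree n.+1 v w.
    split=> h; [exact: agree_trans h zwn | exact: agree_trans h (agree_sym zwn)].
  apply: (agree_tail e1 e2); last by apply: agreeW zw; lia.
  have [xz|xz] := pselect (agree n.+1 x z).
    by apply: (prefix_eq y); [exact: a1 | apply/a2/tr].
  have xw : ~ agree n.+1 x w by move/tr.
  have [yz|yz] := pselect (agree n.+1 y z).
    by apply: (prefix_eq x); [exact: b1 | apply: b2 => //; apply/tr].
  by rewrite c1 // c2 //; [apply: agreeW zwn | move/tr].
have [h [hf _]] := homeo_of fK fK fu fu.
exists h.
  exists (fun=> n); split; try exact: cst_continuous.
  by move=> z; rewrite hf; have [] := fP z.
move=> z w xz yw zw; rewrite hf; have [e a _ _] := fP z.
by apply: (@agree_tail_eq n); [apply: (prefix_eq y) => //; apply: a | rewrite e].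
Qed.

End CylinderSwap.

(** There are finitely many pairs of prefixes of length [n.+1]. One cylinder swap serves all
    tail-equivalent points with a given pair, and the largest of the resulting bounds is uniform. *)
Lemma AF_tail_unif N M (A : 'M[nat]_N) (B : 'M[nat]_M)
    (h : shift_space A -> shift_space B) :
  (forall f, AF_full_group (A := A) f -> exists K : nat, forall x,
    iter K (@shift M B) (h (f x)) = iter K (@shift M B) (h x)) ->
  tail_unif h.
Proof.
move=> hAF n; pose T : finType := {ffun 'I_n.+1 -> 'I_N}.
pose pre (x : shift_space A) : T := [ffun i : 'I_n.+1 => letter x i].
have pre_agree x y : pre x = pre y -> agree n.+1 x y.
  by move=> /ffunP e k kn; have := e (Ordinal kn); rewrite !ffunE.
have /choice[K KP] : forall uv : T * T, exists K, forall x y,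
    pre x = uv.1 -> pre y = uv.2 ->
    iter n (@shift N A) x = iter n (@shift N A) y ->
    iter K (@shift M B) (h x) = iter K (@shift M B) (h y).
  move=> [u v] /=.
  have [[x0 [y0 [<- <- e]]]|no] := pselect (exists x y, [/\ pre x = u, pre y = v &
      iter n (@shift N A) x = iter n (@shift N A) y]); last first.
    by exists 0%N => x y xu yv e; exfalso; apply: no; exists x, y.
  have [f fAF fP] := cylinder_swap e.
  have [K hK] := hAF f fAF; exists K => x y xx0 yy0 xy.
  by rewrite -hK (fP x y) //; apply: pre_agree.
exists (\max_uv K uv) => x y xy.
have Kle := @leq_bigmax _ K (pre x, pre y).
by rewrite -(subnK Kle) !iterD (KP (pre x, pre y) x y erefl erefl xy).
Qed.

Section Conclusion.
Variables (N M : nat) (A : 'M[nat]_N) (B : 'M[nat]_M).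
Implicit Types h : homeo (shift_space A) (shift_space B).
Local Notation sA := (@shift N A).
Local Notation sB := (@shift M B).

Lemma cocycle_agree (k l : shift_space A -> nat) : continuous k -> continuous l ->
  exists n, (forall x, (k x <= n)%N /\ (l x <= n)%N) /\
    forall x y, agree n x y -> cocycle k l x = cocycle k l y.
Proof.
move=> /continuous_agree[a ka] /continuous_agree[b lb].
have [m km] := agree_bounded ka; have [m' lm'] := agree_bounded lb.
exists (a + b + m + m')%N; split=> [x|x y xy].
  by have := km x; have := lm' x; lia.
by rewrite /cocycle (ka x y) ?(lb x y) //; apply: agreeW xy; lia.
Qed.

Lemma unit_step_lag (f : shift_space A -> shift_space B) K :
  step_lag f K (fun=> 1) ->
  forall n d x y, ulag n d x y -> ulag (n * K + n * K) d (f x) (f y).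
Proof.
move=> fK n d x y.
have fq : step_lag f K (fun x => 1 + 0 - 0) by move=> z; rewrite subr0 addr0.
by move=> /(potential_lag fq); rewrite subr0 addr0.
Qed.

Lemma unit_step_tail (f : shift_space A -> shift_space B) K :
  step_lag f K (fun=> 1) -> tail_unif f.
Proof.
move=> fK n; exists (n * K + n * K)%N => x y /ulag0P xy.
exact/ulag0P/(unit_step_lag fK).
Qed.

Lemma unit_steps_eventually_conjugate h K L :
  step_lag h K (fun=> 1) -> step_lag (homeo_inv h) L (fun=> 1) ->
  eventually_conjugate A B.
Proof.
move=> hK gL; exists h, (fun=> K), (fun=> (K + 1)%N), (fun=> L), (fun=> (L + 1)%N).
split=> [|x|w]; try by rewrite /cocycle; lia.
split; try by split; exact: cst_continuous.
- by move=> x; apply/esym/ulag_nat/hK.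
- by move=> w; apply/esym/ulag_nat/gL.
Qed.

(** The inverse also has lag one: [h (shift (homeo_inv h w))] and [shift w] are tail equivalent, and
    the inverse preserves this uniformly. *)
Lemma unit_lag_eventually_conjugate h : unit_lag h -> eventually_conjugate A B.
Proof.
move=> [hT gT [K hK]]; have [m gm] := gT K.
apply: (unit_steps_eventually_conjugate hK (L := (1 + m)%N)) => w.
have e : iter m sA (shift (homeo_inv h w)) = iter m sA (homeo_inv h (shift w)).
  rewrite -[shift (homeo_inv h w)](homeo_funK h); apply: gm.
  have /ulag_nat <- := hK (homeo_inv h w).
  by rewrite homeo_invK addn1 iterSr.
by have /ulag0P := e; move=> /(ulag_trans (ulag_iter 1 _)); rewrite addr0.
Qed.

End Conclusion.

Section CoeData.
Variables (N M : nat) (A : 'M[nat]_N) (B : 'M[nat]_M).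
Variable h : homeo (shift_space A) (shift_space B).
Variables (k1 l1 : shift_space A -> nat) (k2 l2 : shift_space B -> nat).
Hypothesis hcoe : coe_data h k1 l1 k2 l2.

Lemma coe_step : exists K, step_lag h K (cocycle k1 l1) /\
  forall x y, agree K x y -> cocycle k1 l1 x = cocycle k1 l1 y.
Proof.
have [[ck cl] _ h1 _] := hcoe; have [n [nb nc]] := cocycle_agree ck cl.
exists n; split=> // x; have [kn ln] := nb x.
by exists (l1 x), (k1 x); split.
Qed.

Lemma coe_inv_step : exists K, step_lag (homeo_inv h) K (cocycle k2 l2) /\
  forall x y, agree K x y -> cocycle k2 l2 x = cocycle k2 l2 y.
Proof.
have [_ [ck cl] _ h1] := hcoe; have [n [nb nc]] := cocycle_agree ck cl.
exists n; split=> // x; have [kn ln] := nb x.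
by exists (l2 x), (k2 x); split.
Qed.

End CoeData.

Lemma AF_uniform N (A : 'M[nat]_N) f : AF_full_group (A := A) f ->
  exists K : nat, forall x, iter K (@shift N A) (f x) = iter K (@shift N A) x.
Proof.
move=> [k [ck _ fk]]; have [n [nb _]] := cocycle_agree ck ck.
by exists n => x; have [kn _] := nb x; rewrite -(subnK kn) !iterD fk.
Qed.

Lemma homeo_id N (A : 'M[nat]_N) :
  exists f : homeo (shift_space A) (shift_space A), homeo_fun f = id.
Proof.
have idK : cancel (@id (shift_space A)) id by [].
have idu : unif_cont (@id (shift_space A)) by move=> n; exists n.
by have [f [fE _]] := homeo_of idK idK idu idu; exists f.
Qed.

(** * The implications between the three conditions *)

Section Equivalences.
Variables (N M : nat) (A : 'M[nat]_N) (B : 'M[nat]_M).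
Local Notation sA := (@shift N A).
Local Notation sB := (@shift M B).

Lemma eventually_conjugate_uniformly_coe :
  eventually_conjugate A B -> uniformly_coe A B.
Proof.
move=> [h [k1 [l1 [k2 [l2 [hcoe c1 c2]]]]]].
exists h; first by exists k1, l1, k2, l2.
have [K [hK _]] := coe_step hcoe; have [L [gL _]] := coe_inv_step hcoe.
have hT : tail_unif h.
  by apply: (@unit_step_tail _ _ _ _ _ K) => x; rewrite -(c1 x).
have gT : tail_unif (homeo_inv h).
  by apply: (@unit_step_tail _ _ _ _ _ L) => w; rewrite -(c2 w).
move=> f1 f2 /AF_uniform[n1 f1n] /AF_uniform[n2 f2n].
have [K1 hK1] := hT n1; have [K2 gK2] := gT n2.
by exists K1, K2; split=> [x|w]; [apply: hK1 | apply: gK2].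
Qed.

Lemma eventually_conjugate_Gamma_strongly_coe :
  eventually_conjugate A B -> Gamma_strongly_coe A B.
Proof.
move=> [h [k1 [l1 [k2 [l2 [hcoe c1 c2]]]]]].
exists h, k1, l1, k2, l2; split=> //.
have [f fE] := homeo_id A.
exists f, (fun=> 0%N), (fun=> 0%N); split; last first.
  by move=> x; rewrite c1 /cocycle subrr subr0 addr0.
by split; try exact: cst_continuous; rewrite fE.
Qed.

Hypotheses (hA01 : zero_one_mx A) (hB01 : zero_one_mx B).
Hypotheses (hAirr : irreducible_mx A) (hBirr : irreducible_mx B).
Hypotheses (hAperm : ~~ is_perm_mx A) (hBperm : ~~ is_perm_mx B).

(* [h \o f^-1] has constant lag one, and then so does its inverse by rigidity. *)
Lemma Gamma_strongly_coe_eventually_conjugate :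
  Gamma_strongly_coe A B -> eventually_conjugate A B.
Proof.
move=> [h [k1 [l1 [k2 [l2 [hcoe [f [k [l [[ck cl fkl] c1]]]]]]]]]].
pose d := cocycle k l.
have [n [nb nd]] := cocycle_agree ck cl.
have fd x : ulag n (d x) x (f x).
  by have [kn ln] := nb x; exists (l x), (k x); split.
have [K [hK _]] := coe_step hcoe; have [L [gL cL]] := coe_inv_step hcoe.
have [f' [f'E f'I]] := homeo_opp f.
have [h' [h'E g'E]] := homeo_comp f' h.
have fd' x : ulag n (- d (f' x)) x (f' x).
  by rewrite f'E; have := ulag_sym (fd (homeo_inv f x)); rewrite homeo_invK.
have hd : step_lag h K (fun x => 1 + d (shift x) - d x).
  by move=> x; have := hK x; rewrite c1 addrAC.
(* The new potential is [d \o f' - d \o f'], that is, zero. *)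
have [K' hK'] := potential_comp hd fd'.
have {}hK' : step_lag h' K' (fun=> 1).
  by move=> x; have := hK' x; rewrite -h'E !subrr addr0 subr0.
pose g' := homeo_inv h'.
pose e w := - d (homeo_inv h w) + cocycle k2 l2 w + d (homeo_inv h (shift w)).
have ge w : ulag (n + L + n) (e w) (g' w) (g' (shift w)).
  rewrite /g' g'E f'I.
  exact: ulag_trans (ulag_trans (ulag_sym (fd _)) (gL w)) (fd _).
(* Carried back by [h'], the lag [e w] relates [w] to [shift w], as does 1; [e] is locally constant,
   so rigidity identifies the two. *)
have e1 w : e w = 1.
  have [m gm] := homeo_inv_unif h n.
  apply/eqP; rewrite -subr_eq0; apply/eqP.
  apply: (ulag_rigid (n := (m + L).+1) (x := w) hB01 hBirr hBperm
    (K := (n + L + n) * K' + (n + L + n) * K' + 1)) => w' ww'.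
  have -> : e w = e w'.
    rewrite /e (cL w w'); last by apply: agreeW ww'; lia.
    congr (- _ + _ + _); apply: nd; apply: gm; first by apply: agreeW ww'; lia.
    by move=> j jm; rewrite !letter_shift ww' //; lia.
  have := unit_step_lag hK' (ge w'); rewrite /g' !homeo_invK => l1'.
  exact: ulag_trans l1' (ulag_sym (ulag_iter 1 w')).
by apply: (unit_steps_eventually_conjugate hK') => w; rewrite -(e1 w); apply: ge.
Qed.

Lemma uniformly_coe_eventually_conjugate (v : 'I_N) (w : 'I_M) :
  uniformly_coe A B -> eventually_conjugate A B.
Proof.
move=> [h [k1 [l1 [k2 [l2 hcoe]]]] hAF].
have [x0 _] := point_from hA01 hAirr v; have [y0 _] := point_from hB01 hBirr w.
have idAF N' (C : 'M[nat]_N') (f : homeo (shift_space C) (shift_space C)) :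
    homeo_fun f = id -> AF_full_group (A := C) f.
  by move=> fE; exists (fun=> 0%N); split; try exact: cst_continuous; rewrite fE.
(* Uniformity takes an element of each AF full group at once; the identity fills the other place. *)
have [iA iAE] := homeo_id A; have [iB iBE] := homeo_id B.
have hT : tail_unif h.
  apply: AF_tail_unif => f fAF.
  by have [K1 [_ [H _]]] := hAF f iB fAF (idAF _ _ _ iBE); exists K1.
have gT : tail_unif (homeo_inv h).
  apply: AF_tail_unif => f fAF.
  by have [_ [K2 [_ H]]] := hAF iA f (idAF _ _ _ iAE) fAF; exists K2.
have [K [hK cK]] := coe_step hcoe; have [L [gL cL]] := coe_inv_step hcoe.
have [p [phi phiP]] := labelling_exists v hA01 hAirr.
have [p' [phi' phiP']] := labelling_exists w hB01 hBirr.
have [g [gE gI]] := homeo_opp h.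
have c1lab := label_invariant phiP hA01 hAirr cK
  (step_lag_tail hB01 hBirr hBperm hT hK cK).
have c2lab : forall x y, label p' phi' x = label p' phi' y ->
    cocycle k2 l2 x = cocycle k2 l2 y.
  apply: (label_invariant phiP' hB01 hBirr cL).
  by apply: (step_lag_tail (h := g) hA01 hAirr hAperm _ _ cL); rewrite gE.
have sum1 x := step_lag_iter p x hK.
have sum2 x := step_lag_iter p' x gL.
have sE x : \sum_(0 <= t < p) cocycle k1 l1 (iter t sA x) = p%:Z.
  pose s' := \sum_(0 <= t < p') cocycle k2 l2 (iter t sB y0).
  have hs y : ulag (p * K) (\sum_(0 <= t < p) cocycle k1 l1 (iter t sA x))
      (h y) (h (iter p sA y)).
    by rewrite (period_sum_const phiP c1lab x y).
  have gs y : ulag (p' * L) s' (homeo_inv h y) (homeo_inv h (iter p' sB y)).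
    by rewrite /s' (period_sum_const phiP' c2lab y0 y).
  apply: (period_lag_eq hA01 hB01 hAirr hBirr hAperm hBperm hT gT phiP phiP' x0
    hs gs).
  by apply: (period_lag_dvd (h := g) hB01 hBirr _ phiP' phiP y0 (K := (p' * L)%N));
    rewrite gE.
have [q [qlab qE]] := potential_exists phiP x0 c1lab sE.
have hq : step_lag h K (fun x => 1 + q (shift x) - q x).
  by move=> x; rewrite -qE.
have [h' hh'] := straighten v hA01 hB01 hAirr hBirr hAperm phiP hT gT qlab hq.
exact: unit_lag_eventually_conjugate hh'.
Qed.

End Equivalences.

Theorem theorem1p6 (N M : nat) (A : 'M[nat]_N) (B : 'M[nat]_M)
    (hA01 : zero_one_mx A) (hB01 : zero_one_mx B)
    (hAirr : irreducible_mx A) (hBirr : irreducible_mx B)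
    (hAperm : ~~ is_perm_mx A) (hBperm : ~~ is_perm_mx B) :
  (uniformly_coe A B <-> eventually_conjugate A B) /\
  (eventually_conjugate A B <-> Gamma_strongly_coe A B).
Proof.
(* The empty matrix is a permutation matrix, so both alphabets are nonempty. *)
have vertex n (C : 'M[nat]_n) : ~~ is_perm_mx C -> 'I_n.
  case: n C => [|n] C Cperm; last exact: ord0.
  exfalso; move/negP: Cperm; apply; apply/is_perm_mxP; exists (perm.perm (@inj_id 'I_0)).
  by apply/matrixP => -[].
split; split.
- exact: (uniformly_coe_eventually_conjugate hA01 hB01 hAirr hBirr hAperm hBperm
    (vertex _ _ hAperm) (vertex _ _ hBperm)).
- exact: eventually_conjugate_uniformly_coe.
- exact: eventually_conjugate_Gamma_strongly_coe.
- exact: Gamma_strongly_coe_eventually_conjugate.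
Qed.
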